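(* There exist a finite digraph $D=(V,A)$, a function $\lambda\colon A\to\mathbb{R}_+$, and two time-respecting arborescences $T_1$ and $T_2$ in $D$ with distinct roots such that there is no reconfiguration sequence from $T_1$ to $T_2$ all of whose members are time-respecting arborescences in $D$.
   Context: $\mathbb{R}_+$ is the set of non-negative reals. Digraphs may have multiple arcs. For $r\in V$, an $r$-arborescence in $D$ (with root $r$) is a spanning acyclic subgraph of $D$ in which there is exactly one directed path from $r$ to every vertex; an arborescence is an $r$-arborescence for some $r\in V$. A directed path traversing arcs $e_1,\dots,e_k$ in this order is time-respecting for $\lambda$ if $\lambda(e_i)\le\lambda(e_{i+1})$ for $1\le i<k$. An arborescence is time-respecting if every directed path in it is time-respecting. A reconfiguration sequence from $T_1$ to $T_2$ is a sequence $(T^0,\dots,T^\ell)$ of time-respecting arborescences in $D$ with $T^0=T_1$, $T^\ell=T_2$ and $|A(T^i)\setminus A(T^{i+1})|=|A(T^{i+1})\setminus A(T^i)|=1$ for $0\le i<\ell$, where $A(\cdot)$ denotes the arc set. *)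

(* Defs.v *)
From mathcomp Require Import all_boot all_order all_algebra.
From mathcomp Require Import reals.

Set Implicit Arguments.
Unset Strict Implicit.
Unset Printing Implicit Defensive.

Import Order.TTheory GRing.Theory Num.Theory.
Local Open Scope ring_scope.

(* Arcs form a type of their own, so parallel arcs are allowed. *)
Record digraph := Digraph {
  vertex : finType;
  darc : finType;
  src : darc -> vertex;
  tgt : darc -> vertex }.

(* Walks are given by their arcs in order; [::] is the trivial walk. *)
Fixpoint diwalk (D : digraph) (u : vertex D) (p : seq (darc D))
    (v : vertex D) : bool :=
  if p is e :: p' then (src e == u) && diwalk (tgt e) p' v else u == v.

(* Throughout, a spanning subgraph of D is represented by its arc set F. *)
Definition dipath (D : digraph) (F : {set darc D}) (u : vertex D)
    (p : seq (darc D)) (v : vertex D) : bool :=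
  [&& all [in F] p, diwalk u p v & uniq (u :: map (@tgt D) p)].

Definition dicycle (D : digraph) (F : {set darc D}) (u : vertex D)
    (p : seq (darc D)) : bool :=
  [&& p != [::], all [in F] p, diwalk u p u & uniq (map (@tgt D) p)].

Definition acyclic (D : digraph) (F : {set darc D}) : Prop :=
  forall (u : vertex D) (p : seq (darc D)), ~~ dicycle F u p.

Definition is_arborescence (D : digraph) (r : vertex D) (F : {set darc D})
    : Prop :=
  acyclic F /\ forall v : vertex D, exists! p : seq (darc D), dipath F r p v.

Definition time_respecting_path (R : realType) (D : digraph)
    (lambda : darc D -> R) (p : seq (darc D)) : bool :=
  sorted (fun e f => lambda e <= lambda f) p.

Definition time_respecting (R : realType) (D : digraph)
    (lambda : darc D -> R) (F : {set darc D}) : Prop :=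
  forall (u v : vertex D) (p : seq (darc D)),
    dipath F u p v -> time_respecting_path lambda p.

Definition tr_arborescence (R : realType) (D : digraph)
    (lambda : darc D -> R) (r : vertex D) (F : {set darc D}) : Prop :=
  is_arborescence r F /\ time_respecting lambda F.

Definition exchange_step (D : digraph) (F F' : {set darc D}) : bool :=
  (#|F :\: F'| == 1)%N && (#|F' :\: F| == 1)%N.

(* The sequence T^0, ..., T^l is T1 :: s; the roots of its members may vary. *)
Definition reconfiguration_sequence (R : realType) (D : digraph)
    (lambda : darc D -> R) (T1 T2 : {set darc D}) (s : seq {set darc D})
    : Prop :=
  [/\ forall F, F \in T1 :: s -> exists r : vertex D, tr_arborescence lambda r F,
      path (@exchange_step D) T1 s
    & last T1 s = T2].

(* Main.v *)
Require Import Defs.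
From mathcomp Require Import all_boot all_order all_algebra.
From mathcomp Require Import reals.

Import Order.TTheory GRing.Theory Num.Theory.
Local Open Scope ring_scope.

(** The digraph has three vertices a, b, c and four arcs, numbered by their
    labels: 0 : a -> b, 1 : c -> a, 2 : b -> c and 3 : a -> b.  The
    time-respecting arborescences T1 = {0, 2} (root a) and T2 = {1, 3} (root c)
    are directed paths, and T1 is isolated in the reconfiguration graph: an
    exchange leads to {1, 0}, {2, 1} or {3, 2}, each a directed path traversed
    in decreasing order of labels, or to {0, 3}, which enters neither a nor c. *)

Section TwoArcPath.

Context {D : digraph} {e f : darc D}.
Hypothesis ef : tgt e = src f.
Hypothesis uniq_ef : uniq [:: src e; tgt e; tgt f].

(** The three vertices are distinct, so no arc of the set leaves [tgt f] and only [f] leaves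
    [tgt e]. Vertices of [p] are not assumed distinct, so the list also covers closed walks and
    serves to exclude cycles. *)
Lemma two_arc_diwalk u v (p : seq (darc D)) :
    all [in [set e; f]] p -> diwalk u p v ->
  [\/ p = [::] /\ u = v, p = [:: e] /\ (u, v) = (src e, tgt e),
      p = [:: f] /\ (u, v) = (tgt e, tgt f)
    | p = [:: e; f] /\ (u, v) = (src e, tgt f)].
Proof.
move: uniq_ef; rewrite /= !inE negb_or andbT => /andP[/andP[xy xz] yz].
have after_f w q : all [in [set e; f]] q -> diwalk (tgt f) q w ->
    q = [::] /\ w = tgt f.
  case: q => [_ /eqP <- //|g q] /= /andP[+ _] /andP[/eqP + _].
  rewrite !inE => /orP[/eqP-> eqz|/eqP-> eqz].
  - by rewrite eqz eqxx in xz.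
  - by rewrite ef eqz eqxx in yz.
have after_e w q : all [in [set e; f]] q -> diwalk (tgt e) q w ->
    (q = [::] /\ w = tgt e) \/ (q = [:: f] /\ w = tgt f).
  case: q => [_ /eqP <-|g q] /=; first by left.
  move=> /andP[+ qF] /andP[/eqP + gq].
  rewrite !inE => /orP[/eqP ge eqy|/eqP ge _]; subst g.
    by rewrite eqy eqxx in xy.
  by right; have [-> ->] := after_f _ _ qF gq.
case: p => [_ /eqP ->|g p] /=; first by constructor 1.
move=> /andP[+ pF] /andP[/eqP <- gp]; rewrite !inE => /orP[] /eqP ge; subst g.
  by have [[-> ->]|[-> ->]] := after_e _ _ pF gp; [constructor 2|constructor 4].
by have [-> ->] := after_f _ _ pF gp; constructor 3; rewrite ef.
Qed.

Lemma two_arc_dipath : dipath [set e; f] (src e) [:: e; f] (tgt f).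
Proof. by rewrite /dipath uniq_ef /= !inE !eqxx orbT ef eqxx. Qed.

Lemma two_arc_arborescence :
    (forall v, v \in [:: src e; tgt e; tgt f]) ->
  is_arborescence (src e) [set e; f].
Proof.
move=> vE; move: (uniq_ef); rewrite /= !inE negb_or andbT.
move=> /andP[/andP[xy xz] yz]; split=> [u p|v].
  apply/negP => /and4P[p0 pF pu _].
  have [[p_nil _]|[_ [-> h]]|[_ [-> h]]|[_ [-> h]]] :=
    two_arc_diwalk u u p pF pu.
  - by rewrite p_nil in p0.
  - by rewrite h eqxx in xy.
  - by rewrite h eqxx in yz.
  - by rewrite h eqxx in xz.
have uniq_path q : dipath [set e; f] (src e) q v ->
    [\/ q = [::] /\ src e = v, q = [:: e] /\ v = tgt e
      | q = [:: e; f] /\ v = tgt f].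
  case/and3P=> qF qv _.
  have [[-> ->]|[-> [->]]|[_ [h _]]|[-> [->]]] := two_arc_diwalk _ _ _ qF qv.
  - by constructor 1.
  - by constructor 2.
  - by rewrite h eqxx in xy.
  - by constructor 3.
have := vE v; rewrite !inE => /or3P[] /eqP v_eq; subst v.
- exists [::]; split=> [|q /uniq_path[[-> _]|[_ h]|[_ h]]] //.
  + by rewrite /dipath /= eqxx.
  + by rewrite h eqxx in xy.
  + by rewrite h eqxx in xz.
- exists [:: e]; split=> [|q /uniq_path[[_ h]|[-> _]|[_ h]]] //.
  + by rewrite /dipath /= !inE !eqxx xy.
  + by rewrite h eqxx in xy.
  + by rewrite h eqxx in yz.
- exists [:: e; f]; split=> [|q /uniq_path[[_ h]|[_ h]|[-> _]]] //.
  + exact: two_arc_dipath.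
  + by rewrite h eqxx in xz.
  + by rewrite h eqxx in yz.
Qed.

Lemma two_arc_tr_arborescence (R : realType) (lambda : darc D -> R) :
    (forall v, v \in [:: src e; tgt e; tgt f]) -> lambda e <= lambda f ->
  tr_arborescence lambda (src e) [set e; f].
Proof.
move=> vE le_ef; split; first exact: two_arc_arborescence.
move=> u v p /and3P[pF puv _].
have [[-> _]|[-> _]|[-> _]|[-> _]] := two_arc_diwalk _ _ _ pF puv => //.
by rewrite /time_respecting_path /= le_ef.
Qed.

(** Here [F] may contain further arcs: used contrapositively, this forbids any [F] that contains a
    two-arc path with decreasing labels. *)
Lemma time_respecting_two_arcs (R : realType) (lambda : darc D -> R)
    (F : {set darc D}) :
  time_respecting lambda F -> e \in F -> f \in F -> lambda e <= lambda f.
Proof.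
move=> trF eF fF; have := trF (src e) (tgt f) [:: e; f].
rewrite /time_respecting_path /= andbT; apply.
by rewrite /dipath uniq_ef /= eF fF ef !eqxx.
Qed.

End TwoArcPath.

Lemma non_root_entered (D : digraph) (r v : vertex D) (F : {set darc D}) :
  is_arborescence r F -> v != r -> exists2 e, e \in F & tgt e = v.
Proof.
(* The arc sought is the last arc of a path from [r] to [v]. Only the walk and its membership in [F]
   are kept, and the start is generalised, since the induction moves it along the walk. *)
move=> [_ /(_ v)[p [/and3P[pF + _] _]]].
elim: p r pF => [|e p IHp] r /=; first by move=> _ /eqP ->; rewrite eqxx.
move=> /andP[eF pF] /andP[_ pv] _.
by have [->|/(IHp _ pF pv)] := eqVneq v (tgt e); first by exists e.
Qed.

(** The vertices a, b, c are 0, 1, 2. The numbering makes arc k+1 end where arc k starts. *)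
Definition frozen_src (e : 'I_4) : 'I_3 := inord (nth 0 [:: 0; 2; 1; 0] e)%N.
Definition frozen_tgt (e : 'I_4) : 'I_3 := inord (nth 0 [:: 1; 0; 2; 1] e)%N.
Definition frozen_digraph := Digraph frozen_src frozen_tgt.
Definition frozen_label (R : realType) (e : darc frozen_digraph) : R :=
  (e : 'I_4)%:R.
Definition frozen_arc (k : nat) : darc frozen_digraph := inord k : 'I_4.

Lemma label_frozen_arc (R : realType) k :
  (k < 4)%N -> frozen_label R (frozen_arc k) = k%:R.
Proof. by move=> k4; rewrite /frozen_label inordK. Qed.

Lemma src_frozen_arc k :
  (k < 4)%N -> src (frozen_arc k) = inord (nth 0 [:: 0; 2; 1; 0] k)%N.
Proof. by move=> k4; rewrite /= /frozen_src inordK. Qed.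

Lemma tgt_frozen_arc k :
  (k < 4)%N -> tgt (frozen_arc k) = inord (nth 0 [:: 1; 0; 2; 1] k)%N.
Proof. by move=> k4; rewrite /= /frozen_tgt inordK. Qed.

Lemma frozen_arcP (e : darc frozen_digraph) :
  exists2 k, (k < 4)%N & e = frozen_arc k.
Proof. by exists (e : 'I_4) => //; rewrite /frozen_arc inord_val. Qed.

Lemma frozen_vertexP (v : 'I_3) : v \in [:: inord 0; inord 1; inord 2].
Proof. by case: v => [[|[|[|]]]] // h; rewrite !inE -!val_eqE /= !inordK. Qed.

Definition frozen_tree := [set frozen_arc 0; frozen_arc 2].

Lemma frozen_tree_tr_arborescence (R : realType) :
  tr_arborescence (frozen_label R) (inord 0 : 'I_3) frozen_tree.
Proof.
have -> : inord 0 = src (frozen_arc 0) :> 'I_3 by rewrite src_frozen_arc.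
apply: two_arc_tr_arborescence => [|||].
- by rewrite src_frozen_arc ?tgt_frozen_arc.
- by rewrite src_frozen_arc ?tgt_frozen_arc //= !inE -!val_eqE /= !inordK.
- by move=> v; rewrite src_frozen_arc ?tgt_frozen_arc //= frozen_vertexP.
- by rewrite !label_frozen_arc // ler_nat.
Qed.

Definition frozen_target := [set frozen_arc 1; frozen_arc 3].

Lemma frozen_target_tr_arborescence (R : realType) :
  tr_arborescence (frozen_label R) (inord 2 : 'I_3) frozen_target.
Proof.
have -> : inord 2 = src (frozen_arc 1) :> 'I_3 by rewrite src_frozen_arc.
apply: two_arc_tr_arborescence => [|||].
- by rewrite src_frozen_arc ?tgt_frozen_arc.
- by rewrite src_frozen_arc ?tgt_frozen_arc //= !inE -!val_eqE /= !inordK.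
- move=> v; rewrite src_frozen_arc ?tgt_frozen_arc //=.
  (* This path visits the vertices in the order c, a, b, a rotation of the list in
     [frozen_vertexP]. *)
  by have := frozen_vertexP v; rewrite !inE orbA orbC.
- by rewrite !label_frozen_arc // ler_nat.
Qed.

(** Arc k+1 followed by arc k is a directed path through all three vertices, along which the label
    drops. *)
Lemma frozen_arc_descent (R : realType) k (F : {set darc frozen_digraph}) :
    (k < 3)%N -> time_respecting (frozen_label R) F ->
  frozen_arc k.+1 \in F -> frozen_arc k \in F -> False.
Proof.
move=> k3 trF eF fF; have k4 : (k < 4)%N by rewrite ltnW.
have : frozen_label R (frozen_arc k.+1) <= frozen_label R (frozen_arc k).
  apply: time_respecting_two_arcs trF eF fF.
    by rewrite src_frozen_arc ?tgt_frozen_arc //; case: k k3 {k4} => [|[|[|]]].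
  rewrite src_frozen_arc ?tgt_frozen_arc //=.
  by case: k k3 {k4} => [|[|[|]]] //= _; rewrite !inE -!val_eqE /= !inordK.
by rewrite !label_frozen_arc // ler_nat ltnn.
Qed.

(** At most one of a and c is the root; the other must be entered, and the only arc into a is 1, the
    only arc into c is 2. *)
Lemma frozen_arborescence_entered r (F : {set darc frozen_digraph}) :
  is_arborescence r F -> (frozen_arc 1 \in F) || (frozen_arc 2 \in F).
Proof.
move=> arbF; have [r0|r0] := eqVneq (inord 0 : 'I_3) r.
  have [|e eF] := @non_root_entered _ r (inord 2 : 'I_3) F arbF.
    by rewrite -r0 -val_eqE /= !inordK.
  have [k k4 ek] := frozen_arcP e; subst e.
  rewrite tgt_frozen_arc // => /(congr1 val).
  by case: k k4 eF => [|[|[|[|]]]] //= _ eF; rewrite ?eF ?orbT // !inordK.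
have [e eF] := @non_root_entered _ r (inord 0 : 'I_3) F arbF r0.
have [k k4 ek] := frozen_arcP e; subst e.
rewrite tgt_frozen_arc // => /(congr1 val).
by case: k k4 eF => [|[|[|[|]]]] //= _ eF; rewrite ?eF ?orbT // !inordK.
Qed.

Lemma card_frozen_arcs (F : {set darc frozen_digraph}) :
  #|F| = ((frozen_arc 0 \in F) + (frozen_arc 1 \in F) + (frozen_arc 2 \in F)
          + (frozen_arc 3 \in F))%N.
Proof.
rewrite -sum1_card big_mkcond !big_ord_recl big_ord0 /= addn0 !addnA.
(* The expanded sum names the arcs by iterated lifts of [ord0], which agree with [frozen_arc] by
   value. *)
by congr (_ + _ + _ + _)%N; rewrite -[LHS]/(nat_of_bool (_ \in F));
  congr (nat_of_bool (_ \in F)); apply: val_inj; rewrite /= !inordK.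
Qed.

Lemma frozen_tree_isolated (R : realType) r (F : {set darc frozen_digraph}) :
  tr_arborescence (frozen_label R) r F -> ~~ exchange_step frozen_tree F.
Proof.
move=> [arbF trF]; have := frozen_arborescence_entered r F arbF.
have d0 := frozen_arc_descent R 0 F isT trF.
have d1 := frozen_arc_descent R 1 F isT trF.
have d2 := frozen_arc_descent R 2 F isT trF.
rewrite /exchange_step !card_frozen_arcs !inE -!val_eqE /= !inordK //=.
(* Only the four membership bits of [F] remain. An exchange keeps one of 0, 2 and adds one of 1, 3:
   [d0], [d1], [d2] refute {0, 1}, {1, 2}, {2, 3}, and {0, 3} violates the disjunction in the
   goal. *)
by move: d0 d1 d2; do 4!case: (_ \in F) => //=; move=> d0 d1 d2; exfalso; auto.
Qed.

Theorem mainTheorem4 (R : realType) :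
  exists (D : digraph) (lambda : darc D -> R) (r1 r2 : vertex D)
         (T1 T2 : {set darc D}),
    [/\ forall e : darc D, 0 <= lambda e,
        tr_arborescence lambda r1 T1,
        tr_arborescence lambda r2 T2,
        r1 <> r2
      & ~ exists s : seq {set darc D}, reconfiguration_sequence lambda T1 T2 s].
Proof.
exists frozen_digraph, (frozen_label R), (inord 0 : 'I_3), (inord 2 : 'I_3).
exists frozen_tree, frozen_target; split.
- by move=> e; apply: ler0n.
- exact: frozen_tree_tr_arborescence.
- exact: frozen_target_tr_arborescence.
- by move=> /(congr1 val); rewrite /= !inordK.
case=> -[|F s] [arb /= step last_s].
  (* An empty sequence would identify the two trees, but arc 0 lies only in the first. *)
  have : frozen_arc 0 \in frozen_target by rewrite -last_s !inE eqxx.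
  by rewrite !inE -!val_eqE /= !inordK.
have [|r trF] := arb F; first by rewrite !inE eqxx orbT.
by have /andP[/(negP (frozen_tree_isolated R r F trF))] := step.
Qed.
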